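(* Let $\mathfrak{CRB}/\mathbf{k}$ be the category of commutative Rota-Baxter $\mathbf{k}$-algebras of weight $\lambda$. The collection of Rota-Baxter Zariski coverings forms a Grothendieck topology on the opposite category $(\mathfrak{CRB}/\mathbf{k})^{op}$.
   Context: $\mathbf{k}$ is a commutative unitary ring, $\lambda\in\mathbf{k}$ is fixed, and all algebras are commutative unital $\mathbf{k}$-algebras. A Rota-Baxter algebra of weight $\lambda$ is a pair $(R,P)$ with $R$ an algebra and $P:R\to R$ a $\mathbf{k}$-linear map satisfying $P(x)P(y)=P(xP(y)+P(x)y+\lambda xy)$ for all $x,y\in R$. A morphism $f:(R,P)\to(R',P')$ is an algebra homomorphism with $f\circ P=P'\circ f$. A Rota-Baxter ideal is an ideal closed under $P$. Rota-Baxter localization: for a multiplicative subset $S\subseteq R$, it is a commutative Rota-Baxter algebra $(S^{-1}_{RB}R,S^{-1}P)$ with a Rota-Baxter homomorphism $i_S:R\to S^{-1}_{RB}R$ such that (1) the elements of $i_S(S)$ are invertible; (2) for every commutative Rota-Baxter algebra $(R',P_{R'})$ and Rota-Baxter homomorphism $f:R\to R'$ such that $f(S)$ consists of invertible elements, there is a unique Rota-Baxter homomorphism $f_S:S^{-1}_{RB}R\to R'$ with $f_S\circ i_S=f$. It exists and is unique up to isomorphism. A morphism $f:(A,P_A)\to(B,P_B)$ in $\mathfrak{CRB}/\mathbf{k}$ is principal open if there are a multiplicative subset $S\subseteq A$ and an isomorphism $\tau:(B,P_B)\to(S^{-1}_{RB}A,S^{-1}P_A)$ with $\tau\circ f=i_S$.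 A morphism is open if it is a composition of finitely many principal open morphisms. A Rota-Baxter Zariski covering of $(A,P_A)$ is a family of open morphisms $\{(A,P_A)\to(B_i,P_{B_i})\}_{i\in I}$ in $\mathfrak{CRB}/\mathbf{k}$ (viewed as a family of maps to $(A,P_A)$ in the opposite category) for which there exists a multiplicative subset $S\subseteq A$ such that (1) the Rota-Baxter ideal generated by $S$ is $A$; (2) for any $s\in S$ there exists $i\in I$ such that the image of $s$ in $B_i$ is invertible. A Grothendieck topology on a category $\mathfrak{C}$ is a system of distinguished families of maps $\{U_i\to U\}_{i\in I}$, called coverings, such that: (a) for any covering $\{U_i\to U\}_{i\in I}$ and any morphism $V\to U$, the fiber product $U_i\times_U V$ exists for every $i$ and $\{U_i\times_U V\to V\}_{i\in I}$ is a covering of $V$; (b) if $\{U_i\to U\}_{i\in I}$ is a covering and, for each $i\in I$, $\{V_{ij}\to U_i\}_{j\in J_i}$ is a covering, then the family of compositions $\{V_{ij}\to U\}_{j\in J_i,\,i\in I}$ is a covering; (c) for any $U$, the family consisting only of the identity map $U\to U$ is a covering. *)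

(* Defs.v *)
From HB Require Import structures.
From mathcomp Require Import all_boot ssralg.
From mathcomp Require Import boolp classical_sets.
Set Implicit Arguments.
Unset Strict Implicit.
Unset Printing Implicit Defensive.
Import GRing.Theory.
Local Open Scope classical_set_scope.
Local Open Scope ring_scope.

Record category := Category {
  obj :> Type;
  hom : obj -> obj -> Type;
  idm : forall A, hom A A;
  comp : forall A B C, hom B C -> hom A B -> hom A C;
  comp_idl : forall A B (f : hom A B), comp (idm B) f = f;
  comp_idr : forall A B (f : hom A B), comp f (idm A) = f;
  compA : forall A B C D (h : hom C D) (g : hom B C) (f : hom A B),
    comp h (comp g f) = comp (comp h g) f }.

Arguments hom {c} A B.
Arguments idm {c} A.
Arguments comp {c A B C} g f.

Definition op (C : category) : category :=
  @Category C (fun A B => hom B A) idm (fun A B D g f => comp f g)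
    (fun A B f => comp_idr f) (fun A B f => comp_idl f)
    (fun A B D E h g f => esym (compA f g h)).

Definition isomorphism (C : category) (A B : C) (f : hom A B) : Prop :=
  exists g : hom B A, comp g f = idm A /\ comp f g = idm B.

Definition is_fiber_product (C : category) (X Y U : C)
    (f : hom X U) (g : hom Y U) (W : C) (p : hom W X) (q : hom W Y) : Prop :=
  comp f p = comp g q /\
  forall (T : C) (a : hom T X) (b : hom T Y), comp f a = comp g b ->
    exists! h : hom T W, comp p h = a /\ comp q h = b.

Definition family_system (C : category) : Type :=
  forall (U : C) (I : Type) (V : I -> C), (forall i, hom (V i) U) -> Prop.

Arguments is_fiber_product {C X Y U} f g W p q.

(* Fiber products are only defined up to isomorphism, so base change requires  *)
(* that they exist and that every choice of them yields a covering.            *)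
Definition grothendieck_topology (C : category) (cov : family_system C) : Prop :=
  [/\ forall (U : C) (I : Type) (X : I -> C) (f : forall i, hom (X i) U),
        cov U I X f -> forall (V : C) (g : hom V U),
          (forall i, exists (W : C) (p : hom W (X i)) (q : hom W V),
             is_fiber_product (f i) g W p q) /\
          (forall (W : I -> C) (p : forall i, hom (W i) (X i))
                  (q : forall i, hom (W i) V),
             (forall i, is_fiber_product (f i) g (W i) (p i) (q i)) ->
             cov V I W q),
      forall (U : C) (I : Type) (X : I -> C) (f : forall i, hom (X i) U)
             (J : I -> Type) (Y : forall i, J i -> C)
             (g : forall i j, hom (Y i j) (X i)),
        cov U I X f -> (forall i, cov (X i) (J i) (Y i) (g i)) ->
        cov U {i : I & J i} (fun ij => Y (projT1 ij) (projT2 ij))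
          (fun ij => comp (f (projT1 ij)) (g (projT1 ij) (projT2 ij)))
    & forall U : C, cov U unit (fun=> U) (fun=> idm U)].

Arguments grothendieck_topology C cov : clear implicits.

(* The library's comAlgType excludes the zero ring, which is a commutative     *)
(* unital algebra here (it is the localization at any S containing 0), and     *)
(* Hierarchy Builder rejects a new join of comPzRingType and lmodType above    *)
(* the existing comAlgType; hence a plain record.                              *)

Record comPzAlg (k : comPzRingType) := ComPzAlg {
  alg_ring : comPzRingType;
  alg_scale : k -> alg_ring -> alg_ring;
  alg_scaleA : forall a b x,
    alg_scale a (alg_scale b x) = alg_scale (a * b) x;
  alg_scale1 : left_id 1 alg_scale;
  alg_scaleDr : right_distributive alg_scale +%R;
  alg_scaleDl : forall x, {morph alg_scale^~ x : a b / a + b};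
  alg_scaleAl : forall a x y, alg_scale a (x * y) = alg_scale a x * y }.

Definition alg_sort (k : comPzRingType) (A : comPzAlg k) : Type := alg_ring A.
Coercion alg_sort : comPzAlg >-> Sortclass.

HB.instance Definition _ (k : comPzRingType) (A : comPzAlg k) :=
  GRing.ComPzRing.copy (alg_sort A) (alg_ring A).
HB.instance Definition _ (k : comPzRingType) (A : comPzAlg k) :=
  GRing.Zmodule_isLmodule.Build k (alg_sort A) (@alg_scaleA k A)
    (@alg_scale1 k A) (@alg_scaleDr k A) (@alg_scaleDl k A).

Record rbAlg (k : comPzRingType) (lambda : k) := RBAlg {
  rb_alg :> comPzAlg k;
  rb_op : rb_alg -> rb_alg;
  rb_op_linear : linear rb_op;
  rb_opM : forall x y : rb_alg,
    rb_op x * rb_op y = rb_op (x * rb_op y + rb_op x * y + lambda *: (x * y)) }.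

Section RotaBaxterCategory.
Variables (k : comPzRingType) (lambda : k).
Implicit Types A B C : rbAlg lambda.

Record rb_hom A B := RBHom {
  rb_fun :> A -> B;
  rb_hom_linear : linear rb_fun;
  rb_hom_monoid : monoid_morphism rb_fun;
  rb_hom_op : forall x, rb_fun (rb_op x) = rb_op (rb_fun x) }.

Lemma rb_homP A B (f g : rb_hom A B) : f =1 g -> f = g.
Proof.
case: f g => [f f1 f2 f3] [g g1 g2 g3] /= /funext efg; subst g.
by congr RBHom; apply: Prop_irrelevance.
Qed.

Lemma rb_id_linear A : linear (@id A). Proof. by []. Qed.
Lemma rb_id_monoid A : monoid_morphism (@id A). Proof. by []. Qed.

Definition rb_id A : rb_hom A A :=
  RBHom (@rb_id_linear A) (@rb_id_monoid A) (fun=> erefl).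

Section Composition.
Variables (A B C : rbAlg lambda) (g : rb_hom B C) (f : rb_hom A B).

Lemma rb_comp_linear : linear (g \o f).
Proof. by move=> a x y /=; rewrite !rb_hom_linear. Qed.

Lemma rb_comp_monoid : monoid_morphism (g \o f).
Proof.
have [f1 fM] := rb_hom_monoid f; have [g1 gM] := rb_hom_monoid g.
by split=> [|x y] /=; rewrite ?f1 ?fM.
Qed.

Lemma rb_comp_op x : (g \o f) (rb_op x) = rb_op ((g \o f) x).
Proof. by rewrite /= !rb_hom_op. Qed.

Definition rb_comp : rb_hom A C := RBHom rb_comp_linear rb_comp_monoid rb_comp_op.
End Composition.

Definition CRB : category.
Proof.
refine (@Category (rbAlg lambda) rb_hom rb_id rb_comp _ _ _);
  by move=> *; apply: rb_homP.
Defined.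

(* With the usual convention 1 \in S. Merely requiring S nonempty would give    *)
(* the same open morphisms and coverings; allowing S empty would let the empty *)
(* family cover the zero algebra and break transitivity along A -> 0.          *)
Definition multiplicative_subset A (S : set A) : Prop :=
  S 1 /\ forall x y, S x -> S y -> S (x * y).

Definition invertible A (x : A) : Prop := exists y, x * y = 1.

Definition rb_ideal A (J : set A) : Prop :=
  [/\ J 0, forall x y, J x -> J y -> J (x + y),
      forall a x, J x -> J (a * x) & forall x, J x -> J (rb_op x)].

Definition rb_ideal_gen A (S : set A) : set A := smallest (@rb_ideal A) S.

Definition is_rb_localization A (S : set A) (L : rbAlg lambda)
    (iS : rb_hom A L) : Prop :=
  (forall s, S s -> invertible (iS s)) /\
  forall (B : rbAlg lambda) (f : rb_hom A B),
    (forall s, S s -> invertible (f s)) ->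
    exists! fS : rb_hom L B, rb_comp fS iS = f.

(* The Rota-Baxter localization is determined up to isomorphism by its         *)
(* universal property, so any algebra satisfying it may play its role.         *)
Definition principal_open A B (f : rb_hom A B) : Prop :=
  exists (S : set A) (L : rbAlg lambda) (iS : rb_hom A L),
    [/\ multiplicative_subset S, is_rb_localization S iS &
        exists tau : rb_hom B L,
          @isomorphism CRB B L tau /\ rb_comp tau f = iS].

Inductive rb_open A : forall B, rb_hom A B -> Prop :=
| rb_open_principal B (f : rb_hom A B) : principal_open f -> rb_open f
| rb_open_comp B C (f : rb_hom A B) (g : rb_hom B C) :
    rb_open f -> principal_open g -> rb_open (rb_comp g f).

(* A morphism from [B i] to [A] in the opposite category is a Rota-Baxter      *)
(* homomorphism from [A] to [B i].                                             *)
Definition rb_zariski_covering : family_system (op CRB) :=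
  fun (A : rbAlg lambda) I (B : I -> rbAlg lambda)
      (f : forall i, rb_hom A (B i)) =>
    (forall i, rb_open (f i)) /\
    exists S : set A,
      [/\ multiplicative_subset S, rb_ideal_gen S = [set: A] &
          forall s, S s -> exists i, invertible (f i s)].

End RotaBaxterCategory.

(* Main.v *)
From HB Require Import structures.
From mathcomp Require Import all_boot ssralg.
From mathcomp Require Import generic_quotient boolp classical_sets.
Require Import Defs.
Set Implicit Arguments.
Unset Strict Implicit.
Unset Printing Implicit Defensive.
Import GRing.Theory.
Local Open Scope classical_set_scope.
Local Open Scope ring_scope.
Local Open Scope quotient_scope.

(** Since a multiplicative subset contains 1, the subset {1} already generates
    the unit Rota-Baxter ideal, and any covering family has a member in which
    1 is invertible. Hence a covering is exactly a nonempty family of open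
    morphisms ([rb_zariski_coveringP]), and the axioms of a topology become
    closure properties of open morphisms: identities are open, open morphisms
    compose ([rb_open_trans]), and they are stable under base change.

    Fiber products in the opposite category are pushouts of Rota-Baxter
    algebras. A principal open morphism out of A is, up to isomorphism, the
    localization of A at some S; its pushout along g : A -> V is the
    localization of V at g(S), because a morphism b out of V inverts g(S) as
    soon as b g factors through a morphism inverting S, and the component of
    the induced map on the localization of A is then forced by the universal
    property ([principal_open_base_change]). Pasting pushouts extends this to
    compositions ([rb_open_base_change]), and uniqueness of fiber products, with
    the fact that isomorphisms are principal open, extends it to every choice
    of the pushout ([rb_open_fiber_product]).

    What remains is that Rota-Baxter localizations exist. As the operator need
    not extend to the ring of fractions, the localization is
    built by generators and relations: terms over the elements of A and formal
    inverses of those of S, modulo the congruence generated by the axioms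
    ([rb_loc_is_localization]). *)

(** * Rota-Baxter algebras and their morphisms *)

Lemma scalerM1 (k : comPzRingType) (B : comPzAlg k) (a : k) (x : B) :
  (a *: (1 : B)) * x = a *: x.
Proof. by rewrite -[RHS]/(alg_scale a x) -[x in RHS]mul1r alg_scaleAl. Qed.

Section RotaBaxterBasics.
Variables (k : comPzRingType) (lambda : k).

Lemma rb_homD (C D : rbAlg lambda) (h : rb_hom C D) x y : h (x + y) = h x + h y.
Proof. by have := rb_hom_linear h 1 x y; rewrite !scale1r. Qed.

Lemma rb_hom0 (C D : rbAlg lambda) (h : rb_hom C D) : h 0 = 0.
Proof. by apply: (addrI (h 0)); rewrite -rb_homD !addr0. Qed.

Lemma rb_homZ (C D : rbAlg lambda) (h : rb_hom C D) a x : h (a *: x) = a *: h x.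
Proof. by have := rb_hom_linear h a x 0; rewrite !addr0 rb_hom0 addr0. Qed.

Lemma rb_hom1 (C D : rbAlg lambda) (h : rb_hom C D) : h 1 = 1.
Proof. by case: (rb_hom_monoid h). Qed.

Lemma rb_homM (C D : rbAlg lambda) (h : rb_hom C D) x y : h (x * y) = h x * h y.
Proof. by case: (rb_hom_monoid h). Qed.

Lemma rb_opD (C : rbAlg lambda) (x y : C) : rb_op (x + y) = rb_op x + rb_op y.
Proof. by have := @rb_op_linear _ _ C 1 x y; rewrite !scale1r. Qed.

Lemma rb_opZ (C : rbAlg lambda) a (x : C) : rb_op (a *: x) = a *: rb_op x.
Proof.
have op0 : rb_op (0 : C) = 0.
  by apply: (addrI (rb_op 0)); rewrite -rb_opD !addr0.
by have := @rb_op_linear _ _ C a x 0; rewrite !addr0 op0 addr0.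
Qed.

Lemma rb_comp_invertible (A B C : rbAlg lambda)
    (g : rb_hom B C) (f : rb_hom A B) x :
  invertible (f x) -> invertible (rb_comp g f x).
Proof. by case=> y fxy; exists (g y); rewrite /= -rb_homM fxy rb_hom1. Qed.

Lemma rb_compA (A B C D : rbAlg lambda)
    (h : rb_hom C D) (g : rb_hom B C) (f : rb_hom A B) :
  rb_comp h (rb_comp g f) = rb_comp (rb_comp h g) f.
Proof. exact: rb_homP. Qed.

End RotaBaxterBasics.

(** * Existence of Rota-Baxter localizations *)

Section RotaBaxterLocalization.
Variables (k : comPzRingType) (lambda : k) (A : rbAlg lambda) (S : set A).

(** Zero, one, opposites and scalars need no constructors, as they come from A:
    the opposite of [t] is the product of [-1] and [t], and [a *: t] that of
    [a *: 1] and [t]. *)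
Inductive loc_term : Type :=
| LocGen of A
| LocInv s of S s
| LocAdd of loc_term & loc_term
| LocMul of loc_term & loc_term
| LocOp of loc_term.

Definition loc_scale (a : k) (t : loc_term) := LocMul (LocGen (a *: (1 : A))) t.

(** The least congruence making the terms a commutative Rota-Baxter algebra in
    which [LocGen] is a morphism and [LocInv] an inverse. Absorption by 0 is
    among the relations because opposites are defined by multiplication, so
    that their existence relies on it. *)
Inductive loc_eq : loc_term -> loc_term -> Prop :=
| loc_refl t : loc_eq t t
| loc_sym t u : loc_eq t u -> loc_eq u t
| loc_trans u t v : loc_eq t u -> loc_eq u v -> loc_eq t v
| loc_congD t t' u u' :
    loc_eq t t' -> loc_eq u u' -> loc_eq (LocAdd t u) (LocAdd t' u')
| loc_congM t t' u u' :
    loc_eq t t' -> loc_eq u u' -> loc_eq (LocMul t u) (LocMul t' u')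
| loc_congP t t' : loc_eq t t' -> loc_eq (LocOp t) (LocOp t')
| loc_addA t u v : loc_eq (LocAdd t (LocAdd u v)) (LocAdd (LocAdd t u) v)
| loc_addC t u : loc_eq (LocAdd t u) (LocAdd u t)
| loc_add0 t : loc_eq (LocAdd (LocGen 0) t) t
| loc_mulA t u v : loc_eq (LocMul t (LocMul u v)) (LocMul (LocMul t u) v)
| loc_mulC t u : loc_eq (LocMul t u) (LocMul u t)
| loc_mul1 t : loc_eq (LocMul (LocGen 1) t) t
| loc_mul0 t : loc_eq (LocMul (LocGen 0) t) (LocGen 0)
| loc_mulDl t u v :
    loc_eq (LocMul (LocAdd t u) v) (LocAdd (LocMul t v) (LocMul u v))
| loc_genD x y : loc_eq (LocGen (x + y)) (LocAdd (LocGen x) (LocGen y))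
| loc_genM x y : loc_eq (LocGen (x * y)) (LocMul (LocGen x) (LocGen y))
| loc_genP x : loc_eq (LocGen (rb_op x)) (LocOp (LocGen x))
| loc_inv s (Ss : S s) : loc_eq (LocMul (LocGen s) (LocInv Ss)) (LocGen 1)
| loc_opD t u : loc_eq (LocOp (LocAdd t u)) (LocAdd (LocOp t) (LocOp u))
| loc_opZ a t : loc_eq (LocOp (loc_scale a t)) (loc_scale a (LocOp t))
| loc_opM t u :
    loc_eq (LocMul (LocOp t) (LocOp u))
      (LocOp (LocAdd (LocAdd (LocMul t (LocOp u)) (LocMul (LocOp t) u))
                     (loc_scale lambda (LocMul t u)))).

HB.instance Definition _ := gen_eqMixin loc_term.
HB.instance Definition _ := gen_choiceMixin loc_term.

Definition loc_eqb (t u : loc_term) : bool := `[< loc_eq t u >].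

Lemma loc_eqb_refl : reflexive loc_eqb.
Proof. by move=> t; apply/asboolP; exact: loc_refl. Qed.

Lemma loc_eqb_sym : symmetric loc_eqb.
Proof. by move=> t u; apply/asboolP/asboolP; exact: loc_sym. Qed.

Lemma loc_eqb_trans : transitive loc_eqb.
Proof.
by move=> u t v /asboolP tu /asboolP uv; apply/asboolP; exact: loc_trans tu uv.
Qed.

Canonical loc_equiv := EquivRel loc_eqb loc_eqb_refl loc_eqb_sym loc_eqb_trans.

Definition loc_type := {eq_quot loc_equiv}.
HB.instance Definition _ := Quotient.on loc_type.
HB.instance Definition _ := Choice.on loc_type.

Definition loc_class (t : loc_term) : loc_type := \pi_loc_type t.

Lemma loc_classP t u : loc_class t = loc_class u <-> loc_eq t u.
Proof. by split=> [/eqmodP/asboolP | ?] //; apply/eqmodP/asboolP. Qed.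

Lemma loc_class_eq t u : loc_eq t u -> loc_class t = loc_class u.
Proof. by move/loc_classP. Qed.

Lemma loc_repr_eq t : loc_eq (repr (loc_class t)) t.
Proof. by apply/loc_classP; rewrite /loc_class reprK. Qed.

Lemma loc_typeW (Q : loc_type -> Prop) :
  (forall t, Q (loc_class t)) -> forall x, Q x.
Proof. by move=> Qt x; rewrite -[x]reprK. Qed.

Definition loc_add (x y : loc_type) := loc_class (LocAdd (repr x) (repr y)).
Definition loc_mul (x y : loc_type) := loc_class (LocMul (repr x) (repr y)).
Definition loc_op (x : loc_type) := loc_class (LocOp (repr x)).

Lemma loc_addE t u : loc_add (loc_class t) (loc_class u) = loc_class (LocAdd t u).
Proof. by apply/loc_class_eq/loc_congD; exact: loc_repr_eq. Qed.

Lemma loc_mulE t u : loc_mul (loc_class t) (loc_class u) = loc_class (LocMul t u).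
Proof. by apply/loc_class_eq/loc_congM; exact: loc_repr_eq. Qed.

Lemma loc_opE t : loc_op (loc_class t) = loc_class (LocOp t).
Proof. by apply/loc_class_eq/loc_congP/loc_repr_eq. Qed.

Definition loc_gen (x : A) : loc_type := loc_class (LocGen x).

Lemma loc_genDE x y : loc_gen (x + y) = loc_add (loc_gen x) (loc_gen y).
Proof. by rewrite loc_addE; apply/loc_class_eq/loc_genD. Qed.

Lemma loc_genME x y : loc_gen (x * y) = loc_mul (loc_gen x) (loc_gen y).
Proof. by rewrite loc_mulE; apply/loc_class_eq/loc_genM. Qed.

Lemma loc_genPE x : loc_gen (rb_op x) = loc_op (loc_gen x).
Proof. by rewrite loc_opE; apply/loc_class_eq/loc_genP. Qed.

Lemma loc_type_addA : associative loc_add.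
Proof.
by do 3![elim/loc_typeW=> ?]; rewrite !loc_addE; exact/loc_class_eq/loc_addA.
Qed.

Lemma loc_type_addC : commutative loc_add.
Proof.
by do 2![elim/loc_typeW=> ?]; rewrite !loc_addE; exact/loc_class_eq/loc_addC.
Qed.

Lemma loc_type_add0 : left_id (loc_gen 0) loc_add.
Proof. by elim/loc_typeW=> ?; rewrite loc_addE; exact/loc_class_eq/loc_add0. Qed.

Lemma loc_type_mulA : associative loc_mul.
Proof.
by do 3![elim/loc_typeW=> ?]; rewrite !loc_mulE; exact/loc_class_eq/loc_mulA.
Qed.

Lemma loc_type_mulC : commutative loc_mul.
Proof.
by do 2![elim/loc_typeW=> ?]; rewrite !loc_mulE; exact/loc_class_eq/loc_mulC.
Qed.

Lemma loc_type_mul1 : left_id (loc_gen 1) loc_mul.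
Proof. by elim/loc_typeW=> ?; rewrite loc_mulE; exact/loc_class_eq/loc_mul1. Qed.

Lemma loc_type_mul0 x : loc_mul (loc_gen 0) x = loc_gen 0.
Proof.
by elim/loc_typeW: x => ?; rewrite loc_mulE; exact/loc_class_eq/loc_mul0.
Qed.

Lemma loc_type_mulDl : left_distributive loc_mul loc_add.
Proof.
by do 3![elim/loc_typeW=> ?]; rewrite !(loc_addE, loc_mulE);
  exact/loc_class_eq/loc_mulDl.
Qed.

Definition loc_opp (x : loc_type) := loc_mul (loc_gen (-1)) x.

Lemma loc_type_addN : left_inverse (loc_gen 0) loc_opp loc_add.
Proof.
move=> x; rewrite /loc_opp -[X in loc_add _ X]loc_type_mul1 -loc_type_mulDl.
by rewrite -loc_genDE addNr loc_type_mul0.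
Qed.

HB.instance Definition _ := GRing.isZmodule.Build loc_type
  loc_type_addA loc_type_addC loc_type_add0 loc_type_addN.
HB.instance Definition _ := GRing.Zmodule_isComPzRing.Build loc_type
  loc_type_mulA loc_type_mulC loc_type_mul1 loc_type_mulDl.

Definition loc_scaler (a : k) (x : loc_type) : loc_type :=
  loc_gen (a *: (1 : A)) * x.

Lemma loc_scalerA a b x : loc_scaler a (loc_scaler b x) = loc_scaler (a * b) x.
Proof.
rewrite /loc_scaler mulrA; congr (_ * _).
by rewrite -[LHS]loc_genME scalerM1 scalerA.
Qed.

Lemma loc_scaler1 : left_id 1 loc_scaler.
Proof. by move=> x; rewrite /loc_scaler scale1r; exact: mul1r. Qed.

Lemma loc_scalerDr : right_distributive loc_scaler +%R.
Proof. by move=> a x y; exact: mulrDr. Qed.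

Lemma loc_scalerDl x : {morph loc_scaler^~ x : a b / a + b}.
Proof.
move=> a b; rewrite /loc_scaler scalerDl -mulrDl; congr (_ * _).
exact: loc_genDE.
Qed.

Lemma loc_scalerAl a x y : loc_scaler a (x * y) = loc_scaler a x * y.
Proof. exact: mulrA. Qed.

Definition loc_alg : comPzAlg k :=
  ComPzAlg loc_scalerA loc_scaler1 loc_scalerDr loc_scalerDl loc_scalerAl.

Lemma loc_type_opD x y : loc_op (loc_add x y) = loc_add (loc_op x) (loc_op y).
Proof.
elim/loc_typeW: x => ?; elim/loc_typeW: y => ?.
by rewrite !(loc_addE, loc_opE); exact/loc_class_eq/loc_opD.
Qed.

Lemma loc_scalerE a t : loc_scaler a (loc_class t) = loc_class (loc_scale a t).
Proof. exact: loc_mulE. Qed.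

Lemma loc_type_opZ a x : loc_op (loc_scaler a x) = loc_scaler a (loc_op x).
Proof.
elim/loc_typeW: x => ?.
by rewrite !(loc_scalerE, loc_opE); exact/loc_class_eq/loc_opZ.
Qed.

Lemma loc_op_linear : linear (loc_op : loc_alg -> loc_alg).
Proof.
by move=> a x y; rewrite -[LHS]/(loc_op (loc_add _ _)) loc_type_opD loc_type_opZ.
Qed.

Lemma loc_type_opM (x y : loc_alg) :
  (loc_op x : loc_alg) * loc_op y =
  loc_op (x * loc_op y + (loc_op x : loc_alg) * y + lambda *: (x * y)).
Proof.
have: loc_mul (loc_op x) (loc_op y) =
  loc_op (loc_add (loc_add (loc_mul x (loc_op y)) (loc_mul (loc_op x) y))
            (loc_scaler lambda (loc_mul x y))); last by [].
elim/loc_typeW: x => ?; elim/loc_typeW: y => ?.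
by rewrite !(loc_addE, loc_mulE, loc_opE, loc_scalerE);
  exact/loc_class_eq/loc_opM.
Qed.

Definition rb_loc : rbAlg lambda := RBAlg loc_op_linear loc_type_opM.

Lemma loc_gen_linear : linear (loc_gen : A -> rb_loc).
Proof.
move=> a x y; by rewrite loc_genDE -[in LHS]scalerM1 loc_genME.
Qed.

Lemma loc_gen_monoid : monoid_morphism (loc_gen : A -> rb_loc).
Proof. by split=> // x y; exact: loc_genME. Qed.

Definition rb_loc_map : rb_hom A rb_loc :=
  @RBHom _ _ A rb_loc loc_gen loc_gen_linear loc_gen_monoid loc_genPE.

Lemma rb_loc_map_inv s : S s -> invertible (rb_loc_map s).
Proof.
move=> Ss; exists (loc_class (LocInv Ss)).
rewrite -[LHS]/(loc_mul _ _) loc_mulE; exact/loc_class_eq/loc_inv.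
Qed.

Section UniversalProperty.
Variables (B : rbAlg lambda) (f : rb_hom A B).
Hypothesis f_inv : forall s, S s -> invertible (f s).

(** The value of a formal inverse is chosen arbitrarily among the inverses of
    [f s]; the default 0 is never reached under the assumption on [f]. *)
Fixpoint loc_eval (t : loc_term) : B :=
  match t with
  | LocGen x => f x
  | LocInv s _ => xget 0 [set y | f s * y = 1]
  | LocAdd t u => loc_eval t + loc_eval u
  | LocMul t u => loc_eval t * loc_eval u
  | LocOp t => rb_op (loc_eval t)
  end.

Lemma rb_hom_scalar a y : f (a *: (1 : A)) * y = a *: y.
Proof. by rewrite rb_homZ rb_hom1 scalerM1. Qed.

Lemma loc_eval_eq t u : loc_eq t u -> loc_eval t = loc_eval u.
Proof.
elim=> {t u} //.
- by move=> u t v _ -> _ ->.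
- by move=> t t' u u' _ /= -> _ ->.
- by move=> t t' u u' _ /= -> _ ->.
- by move=> t t' _ /= ->.
- by move=> *; exact: addrA.
- by move=> *; exact: addrC.
- by move=> t /=; rewrite rb_hom0 add0r.
- by move=> *; exact: mulrA.
- by move=> *; exact: mulrC.
- by move=> t /=; rewrite rb_hom1 mul1r.
- by move=> t /=; rewrite rb_hom0 mul0r.
- by move=> *; exact: mulrDl.
- by move=> *; exact: rb_homD.
- by move=> *; exact: rb_homM.
- by move=> *; exact: rb_hom_op.
- move=> s Ss /=; rewrite rb_hom1.
  by case: (f_inv Ss) => y fsy; exact: (@xgetI _ _ [set y | f s * y = 1] y).
- by move=> *; exact: rb_opD.
- by move=> a t; rewrite /= !rb_hom_scalar rb_opZ.
- move=> t u; by rewrite /= rb_hom_scalar; exact: rb_opM.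
Qed.

Definition loc_lift (x : rb_loc) : B := loc_eval (repr (x : loc_type)).

Lemma loc_liftE t : loc_lift (loc_class t) = loc_eval t.
Proof. exact/loc_eval_eq/loc_repr_eq. Qed.

Lemma loc_lift_linear : linear loc_lift.
Proof.
move=> a; elim/loc_typeW=> t; elim/loc_typeW=> u.
have -> : a *: (loc_class t : rb_loc) + loc_class u =
    loc_class (LocAdd (loc_scale a t) u).
  by rewrite -loc_addE -loc_mulE.
by rewrite !loc_liftE /= rb_hom_scalar.
Qed.

Lemma loc_lift_monoid : monoid_morphism loc_lift.
Proof.
split; first by rewrite -[1]/(loc_gen 1) loc_liftE /= rb_hom1.
elim/loc_typeW=> t; elim/loc_typeW=> u.
by rewrite -[X in loc_lift X]/(loc_mul _ _) loc_mulE !loc_liftE.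
Qed.

Lemma loc_lift_op x : loc_lift (rb_op x) = rb_op (loc_lift x).
Proof.
elim/loc_typeW: x => t.
by rewrite -[X in loc_lift X]/(loc_op _) loc_opE !loc_liftE.
Qed.

Definition rb_loc_lift : rb_hom rb_loc B :=
  RBHom loc_lift_linear loc_lift_monoid loc_lift_op.

Lemma rb_loc_liftK : rb_comp rb_loc_lift rb_loc_map = f.
Proof. by apply: rb_homP => x; exact: loc_liftE. Qed.

(** The terms are generated by A and the formal inverses, and an inverse in a
    commutative ring is unique, so a morphism out of the localization is
    determined by its restriction to A. *)
Lemma rb_loc_hom_ext (g h : rb_hom rb_loc B) :
  rb_comp g rb_loc_map = rb_comp h rb_loc_map -> g = h.
Proof.
move=> gh; apply: rb_homP; elim/loc_typeW.
have ghE x : g (loc_gen x) = h (loc_gen x).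
  by have := congr1 (@^~ x) (congr1 (@rb_fun _ _ _ _) gh).
elim=> [x | s Ss | t IHt u IHu | t IHt u IHu | t IHt].
- exact: ghE.
- (* g(1/s) = g(1/s) h(s) h(1/s) = g(1/s) g(s) h(1/s) = h(1/s) *)
  have inv_l : loc_gen s * loc_class (LocInv Ss) = 1 :> rb_loc.
    rewrite -[LHS]/(loc_mul _ _) loc_mulE; exact/loc_class_eq/loc_inv.
  have inv_h (e : rb_hom rb_loc B) :
      e (loc_gen s) * e (loc_class (LocInv Ss)) = 1.
    by rewrite -rb_homM inv_l rb_hom1.
  by rewrite -[LHS]mulr1 -(inv_h h) mulrCA -ghE mulrA inv_h mul1r.
- by rewrite -loc_addE -[loc_add _ _]/((_ : rb_loc) + _) !rb_homD IHt IHu.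
- by rewrite -loc_mulE -[loc_mul _ _]/((_ : rb_loc) * _) !rb_homM IHt IHu.
- by rewrite -loc_opE -[loc_op _]/(rb_op (_ : rb_loc)) !rb_hom_op IHt.
Qed.

End UniversalProperty.

Lemma rb_loc_is_localization : is_rb_localization S rb_loc_map.
Proof.
split=> [s|B f f_inv]; first exact: rb_loc_map_inv.
exists (rb_loc_lift f_inv); split; first exact: rb_loc_liftK.
by move=> h hf; apply: rb_loc_hom_ext; rewrite rb_loc_liftK hf.
Qed.

End RotaBaxterLocalization.

(** * Fiber products in a category *)

Section FiberProducts.
Variable C : category.

(** Pasting of cartesian squares: base change along a composition can be done
    in two steps. *)
Lemma fiber_product_paste (X' X Y U W W' : C) (f : hom X U) (f' : hom X' X)
    (g : hom Y U) (p : hom W X) (q : hom W Y) (p' : hom W' X') (q' : hom W' W) :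
  is_fiber_product f g W p q -> is_fiber_product f' p W' p' q' ->
  is_fiber_product (comp f f') g W' p' (comp q q').
Proof.
move=> [fp univ] [fp' univ']; split.
  by rewrite -compA fp' compA fp compA.
move=> T a b fab.
have [|h0 [[ph0 qh0] h0_uniq]] := univ T (comp f' a) b; first by rewrite compA.
have [|h [[ph qh] h_uniq]] := univ' T a h0; first by rewrite ph0.
exists h; split; first by rewrite -compA qh.
move=> h' [ph' qh']; apply: h_uniq; split=> //.
by apply/esym/h0_uniq; split; rewrite compA // -fp' -compA ph'.
Qed.

Lemma fiber_product_iso (X Y U W W' : C) (f : hom X U) (g : hom Y U)
    (p : hom W X) (q : hom W Y) (p' : hom W' X) (q' : hom W' Y) :
  is_fiber_product f g W p q -> is_fiber_product f g W' p' q' ->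
  exists (e : hom W' W) (e' : hom W W'),
    [/\ comp q e = q', comp e e' = idm W & comp e' e = idm W'].
Proof.
move=> [fp univ] [fp' univ'].
have [e [[pe qe] _]] := univ W' p' q' fp'.
have [e' [[pe' qe'] _]] := univ' W p q fp.
exists e, e'; split=> //.
  have [i [_ i_uniq]] := univ W p q fp.
  rewrite -(i_uniq (comp e e')); last by rewrite !compA pe qe.
  by apply: i_uniq; rewrite !comp_idr.
have [i [_ i_uniq]] := univ' W' p' q' fp'.
rewrite -(i_uniq (comp e' e)); last by rewrite !compA pe' qe'.
by apply: i_uniq; rewrite !comp_idr.
Qed.

End FiberProducts.

(** * Open morphisms: composition and base change *)

Section OpenMorphisms.
Variables (k : comPzRingType) (lambda : k).
Implicit Types A B C V : rbAlg lambda.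

(** The universal property is invariant under isomorphism, so a principal open
    morphism is itself a localization, without an auxiliary algebra. *)
Lemma principal_openP A B (f : rb_hom A B) :
  principal_open f <->
  exists S : set A, multiplicative_subset S /\ is_rb_localization S f.
Proof.
split=> [|[S [mulS locS]]].
  move=> [S [L [iS [mulS [iS_inv univ] [tau [[u [utau _]] tauf]]]]]].
  have uiS : rb_comp u iS = f.
    by rewrite -tauf rb_compA; move: utau => /= ->; exact: rb_homP.
  exists S; split=> //; split=> [s Ss|D h h_inv].
    by rewrite -uiS; apply/rb_comp_invertible/iS_inv.
  have [hS [hSiS hS_uniq]] := univ D h h_inv.
  exists (rb_comp hS tau); split=> [|h' h'f]; first by rewrite -rb_compA tauf.
  have -> : hS = rb_comp h' u by apply: hS_uniq; rewrite -rb_compA uiS.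
  by rewrite -rb_compA; move: utau => /= ->; exact: rb_homP.
exists S, B, f; split=> //; exists (rb_id B); split; last exact: rb_homP.
by exists (rb_id B); split; exact: rb_homP.
Qed.

(** Localizing at {1} changes nothing. *)
Lemma principal_open_iso A B (e : rb_hom A B) (e' : rb_hom B A) :
  rb_comp e' e = rb_id A -> rb_comp e e' = rb_id B -> principal_open e.
Proof.
move=> e'e ee'; apply/principal_openP; exists [set 1]; split.
  by split=> // x y -> ->; rewrite /= mulr1.
split=> [_ ->|D h _]; first by exists 1; rewrite mulr1 rb_hom1.
exists (rb_comp h e'); split=> [|h' <-].
  by rewrite -rb_compA e'e; exact: rb_homP.
by rewrite -rb_compA ee'; exact: rb_homP.
Qed.

Lemma rb_open_id A : rb_open (rb_id A).
Proof.
by apply/rb_open_principal/(@principal_open_iso _ _ _ (rb_id A)); exact: rb_homP.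
Qed.

Lemma rb_open_trans A B C (f : rb_hom A B) (g : rb_hom B C) :
  rb_open f -> rb_open g -> rb_open (rb_comp g f).
Proof.
move=> f_open g_open; elim: g_open => {C g} [C g g_princ|C D g h _ IH h_princ].
  exact: rb_open_comp.
by rewrite -rb_compA; exact: rb_open_comp.
Qed.

(** The pushout of the localization at [S] along [g] is the localization at
    [g @` S]: a morphism [b] out of [V] such that [rb_comp b g] factors through
    [f] inverts [g @` S]. *)
Lemma principal_open_base_change A B V (f : rb_hom A B) (g : rb_hom A V) :
  principal_open f ->
  exists (W : rbAlg lambda) (p : rb_hom B W) (q : rb_hom V W),
    @is_fiber_product (op (CRB lambda)) B V A f g W p q /\ principal_open q.
Proof.
move=> /principal_openP[S [[S1 SM] [f_inv univ]]].
pose q := rb_loc_map (g @` S).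
have qloc : is_rb_localization (g @` S) q by exact: rb_loc_is_localization.
have [q_inv q_univ] := qloc.
have [|p [pf _]] := univ _ (rb_comp q g).
  by move=> s Ss; apply: q_inv; exists s.
exists (rb_loc (g @` S)), p, q; split; last first.
  apply/principal_openP; exists (g @` S); split=> //; split.
    by exists 1; rewrite ?rb_hom1.
  by move=> _ _ [x Sx <-] [y Sy <-]; exists (x * y); [exact: SM|exact: rb_homM].
split=> //= T a b af_bg.
have af_inv s : S s -> invertible (rb_comp a f s).
  by move=> Ss; apply/rb_comp_invertible/f_inv.
have [|h [hq h_uniq]] := q_univ T b.
  by move=> _ [s Ss <-]; have := af_inv s Ss; rewrite af_bg.
exists h; split=> [|h' [_ h'q]]; last exact: h_uniq.
(* Both [a] and [rb_comp h p] extend [rb_comp a f] to the localization [B]. *)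
split=> //; have [c [_ c_uniq]] := univ T _ af_inv.
rewrite -(c_uniq a) //; apply/esym/c_uniq.
by rewrite -rb_compA pf rb_compA hq af_bg.
Qed.

Lemma rb_open_base_change A B V (f : rb_hom A B) (g : rb_hom A V) :
  rb_open f ->
  exists (W : rbAlg lambda) (p : rb_hom B W) (q : rb_hom V W),
    @is_fiber_product (op (CRB lambda)) B V A f g W p q /\ rb_open q.
Proof.
move=> f_open; elim: f_open => {B f} [B f f_princ|B C f h _ IH h_princ].
  have [W [p [q [fp q_princ]]]] := principal_open_base_change g f_princ.
  by exists W, p, q; split=> //; exact: rb_open_principal.
have [W [p [q [fp q_open]]]] := IH.
have [W' [p' [q' [fp' q'_princ]]]] := principal_open_base_change p h_princ.
exists W', p', (rb_comp q' q); split; last exact: rb_open_comp.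
exact: (fiber_product_paste fp fp').
Qed.

(** The chosen fiber product differs by an isomorphism from the one obtained by
    iterated localization, and an isomorphism is principal open. *)
Lemma rb_open_fiber_product A B V W (f : rb_hom A B) (g : rb_hom A V)
    (p : rb_hom B W) (q : rb_hom V W) :
  rb_open f -> @is_fiber_product (op (CRB lambda)) B V A f g W p q -> rb_open q.
Proof.
move=> f_open fp.
have [W0 [p0 [q0 [fp0 q0_open]]]] := rb_open_base_change g f_open.
have [e [e' [/= <- ee' e'e]]] := fiber_product_iso fp0 fp.
apply: rb_open_comp => //; exact: (principal_open_iso ee' e'e).
Qed.

(** The subset {1} can always serve as the witness of a covering, and it imposes
    nothing beyond the existence of an index. *)
Lemma rb_zariski_coveringP A I (B : I -> rbAlg lambda)
    (f : forall i, rb_hom A (B i)) :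
  rb_zariski_covering f <-> (forall i, rb_open (f i)) /\ inhabited I.
Proof.
split=> [[f_open [S [[S1 _] _ S_inv]]]|[f_open [i]]].
  by split=> //; have [i _] := S_inv _ S1.
split=> //; exists [set 1]; split.
- by split=> // x y -> ->; rewrite /= mulr1.
- apply/seteqP; split=> // x _ J [[_ _ JM _] J1].
  by rewrite -[x]mulr1; apply/JM/J1.
- by move=> _ ->; exists i, 1; rewrite mulr1 rb_hom1.
Qed.

End OpenMorphisms.

Theorem theorem4p9 (k : comPzRingType) (lambda : k) :
  grothendieck_topology (op (CRB lambda)) (@rb_zariski_covering k lambda).
Proof.
split.
- move=> A I B f /rb_zariski_coveringP[f_open I_inh] V g; split=> [i|W p q fp].
    have [W [p [q [fp _]]]] := rb_open_base_change g (f_open i).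
    by exists W, p, q.
  apply/rb_zariski_coveringP; split=> // i.
  exact: rb_open_fiber_product (f_open i) (fp i).
- move=> A I B f J D g /rb_zariski_coveringP[f_open [i]] g_cov.
  apply/rb_zariski_coveringP; split.
    move=> [i' j] /=; have /rb_zariski_coveringP[g_open _] := g_cov i'.
    exact: rb_open_trans.
  have /rb_zariski_coveringP[_ [j]] := g_cov i.
  by split; exists i.
- by move=> A; apply/rb_zariski_coveringP; split=> [_|]; [exact: rb_open_id|split].
Qed.
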